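(* Let $(G_n)$ be either the family $G_n=K_n$, the complete graph on $n$ vertices, or a family $G_n=K_{n_1,n_2}$, where $K_{n_1,n_2}$ is a complete bipartite graph on $n_1+n_2=n$ vertices (with $n_1=n_1(n),\,n_2=n_2(n)\ge 1$). Then $(G_n)$ belongs to the spectral class $\delta_1$, where $\delta_1$ is the Dirac measure supported at $1$.
   Context: For a simple graph $G=(V,E)$ with $N=|V|$ vertices, the normalized Laplacian acts on functions $f:V\to\mathbb{R}$ by $\Delta_G f(x)=f(x)-\frac{1}{d_x}\sum_{y\sim x}f(y)$, where $d_x$ is the degree of $x$. Its spectrum consists of $N$ eigenvalues (with multiplicity) $0=\lambda_0\le\cdots\le\lambda_{N-1}\le 2$. The associated probability measure on $[0,2]$ is $\mu(G)=\frac1N\sum_{i=0}^{N-1}\delta_{\lambda_i}$, where $\delta_a$ is the Dirac measure at $a$. A family $(G_n)$ of graphs belongs to the spectral class $\rho$, where $\rho$ is a Radon measure on $[0,2]$, if $\mu(G_n)$ converges weakly to $\rho$ as $n\to\infty$, i.e. $\int f\,d\mu(G_n)\to\int f\,d\rho$ for all continuous $f:[0,2]\to\mathbb{R}$. *)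

(* Defs.v *)
From mathcomp Require Import all_boot all_order all_algebra.
From mathcomp Require Import all_classical all_reals all_analysis.
From mathcomp Require Import complex.

Set Implicit Arguments.
Unset Strict Implicit.
Unset Printing Implicit Defensive.

Import Order.TTheory GRing.Theory Num.Theory.
From mathcomp Require Import ring lra.
Import numFieldNormedType.Exports.

Local Open Scope classical_set_scope.
Local Open Scope ring_scope.

Record sgraph := SGraph {
  vertex :> finType;
  adj : rel vertex;
  adj_sym : symmetric adj;
  adj_irrefl : irreflexive adj }.

Arguments adj {s} _ _ : rename.

Definition degree (G : sgraph) (x : G) : nat := #|[set y | adj x y]%SET|.

Section Complete.
Variable n : nat.

Definition complete_adj : rel 'I_n := [rel x y | x != y].

Lemma complete_adj_sym : symmetric complete_adj.
Proof. by move=> x y; rewrite /complete_adj /= eq_sym. Qed.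

Lemma complete_adj_irrefl : irreflexive complete_adj.
Proof. by move=> x; rewrite /complete_adj /= eqxx. Qed.

Definition complete_graph : sgraph :=
  SGraph complete_adj_sym complete_adj_irrefl.

End Complete.

Section CompleteBipartite.
Variables n1 n2 : nat.

Definition complete_bipartite_adj : rel ('I_n1 + 'I_n2)%type :=
  fun x y => match x, y with
             | inl _, inr _ | inr _, inl _ => true
             | _, _ => false
             end.

Lemma complete_bipartite_adj_sym : symmetric complete_bipartite_adj.
Proof. by move=> [x|x] [y|y]. Qed.

Lemma complete_bipartite_adj_irrefl : irreflexive complete_bipartite_adj.
Proof. by move=> [x|x]. Qed.

Definition complete_bipartite_graph : sgraph :=
  SGraph complete_bipartite_adj_sym complete_bipartite_adj_irrefl.

End CompleteBipartite.

Section Spectrum.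
Variables (R : realType) (G : sgraph).

(* At an isolated vertex the sum is empty, so the value is [f x] whatever
   [0^-1] is. *)
Definition laplacian (f : {ffun G -> R}) : {ffun G -> R} :=
  [ffun x => f x - (degree x)%:R^-1 * \sum_(y : G | adj x y) f y].

(* The matrix of [laplacian] in the basis of the indicator functions of the
   vertices, acting on column vectors. *)
Definition laplacian_mx : 'M[R]_#|G| :=
  \matrix_(i, j) laplacian [ffun x => (x == enum_val j)%:R] (enum_val i).

(* The nondecreasing list of eigenvalues, repeated according to algebraic
   multiplicity. *)
Definition is_spectrum (s : seq R) : Prop :=
  sorted <=%R s /\ char_poly laplacian_mx = \prod_(a <- s) ('X - a%:P).

Lemma laplacian_mxE i j : laplacian_mx i j =
  (i == j)%:R - (degree (enum_val i))%:R^-1 *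
                (adj (enum_val i) (enum_val j))%:R.
Proof.
rewrite !mxE !ffunE (inj_eq enum_val_inj); congr (_ - _ * _).
under eq_bigr do rewrite ffunE mulrb.
rewrite -big_mkcondr /=.
case: (boolP (adj _ _)) => h.
  rewrite (big_pred1 (enum_val j)) // => y /=.
  by case: eqP => [->|]; rewrite ?h ?andbF.
by rewrite big_pred0 // => y; case: eqP => [->|]; rewrite ?(negbTE h) ?andbF.
Qed.

Lemma laplacian_mxP (f : {ffun G -> R}) i :
  (laplacian_mx *m \col_j f (enum_val j)) i 0 = laplacian f (enum_val i).
Proof.
rewrite !mxE ffunE.
under eq_bigr do rewrite laplacian_mxE mxE mulrBl -mulrA.
rewrite sumrB -mulr_sumr; congr (_ - _ * _).
  rewrite (bigD1 i) //= eqxx mul1r big1 ?addr0 // => j ji.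
  by rewrite eq_sym (negbTE ji) mul0r.
rewrite [RHS]big_mkcond (reindex (@enum_val G predT)) /=; last first.
  by apply: onW_bij; exact: enum_val_bij.
by apply: eq_bigr => j _; case: adj; rewrite ?mul1r ?mul0r.
Qed.

Lemma laplacian_eigenvalue_real (z : R[i]) :
  eigenvalue (map_mx (real_complex R) laplacian_mx) z -> z \is Num.real.
Proof.
move=> /eigenvalueP[v vE v0].
pose w (i : 'I_#|G|) : R := (maxn 1 (degree (enum_val i : G)))%:R.
have w_gt0 i : 0 < w i by rewrite ltr0n leq_max.
pose S i j := w i * laplacian_mx i j.
have SE i j : S i j =
    w i * (i == j)%:R - (adj (enum_val i) (enum_val j))%:R.
  rewrite /S laplacian_mxE mulrBr; congr (_ - _).
  case: (boolP (adj _ _)) => h; last by rewrite !mulr0.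
  have d0 : (0 < degree (enum_val i))%N.
    by apply/card_gt0P; exists (enum_val j); rewrite inE.
  by rewrite mulr1 /w (maxn_idPr d0) mulfV // pnatr_eq0 -lt0n.
have S_sym i j : S i j = S j i.
  rewrite !SE adj_sym eq_sym; congr (_ - _).
  by case: eqP => [->|]; rewrite ?mulr0.
pose c := real_complex R.
pose u i := v 0 i / c (w i).
have wu i : v 0 i = c (w i) * u i.
  by rewrite /u mulrC divfK // fmorph_eq0 gt_eqF.
move: u wu => u wu.
pose q := \sum_j c (w j) * (u j * (u j)^*).
pose p := \sum_j \sum_i c (S i j) * (u i * (u j)^*).
have c_real x : (c x)^* = c x.
  by apply: conj_Creal; rewrite realE /c !lecR -realE num_real.
have pq : p = z * q.
  rewrite /p /q mulr_sumr; apply: eq_bigr => j _.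
  have := congr1 (fun M : 'rV_ _ => M 0 j) vE; rewrite !mxE => vEj.
  have -> : z * (c (w j) * (u j * (u j)^*)) = z * v 0 j * (u j)^*.
    by rewrite wu; ring.
  rewrite -vEj mulr_suml.
  by apply: eq_bigr => i _; rewrite mxE wu /S /c rmorphM /=; ring.
have p_real : p^* = p.
  rewrite /p rmorph_sum exchange_big /=; apply: eq_bigr => i _.
  rewrite rmorph_sum /=; apply: eq_bigr => j _.
  by rewrite !rmorphM /= c_real conjCK (S_sym j i) (mulrC (u i)).
have q_ge0 j : 0 <= c (w j) * (u j * (u j)^*).
  by rewrite mulr_ge0 ?mul_conjC_ge0 // /c lecR ltW.
have q_neq0 : q != 0.
  apply: contraNneq v0 => /eqP; rewrite psumr_eq0 // => /allP q0.
  apply/eqP/rowP => j; rewrite mxE wu.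
  have := q0 j (mem_index_enum j); rewrite /= mulf_eq0 => /orP[/eqP->|].
    by rewrite mul0r.
  by rewrite mul_conjC_eq0 => /eqP ->; rewrite mulr0.
have q_real : q \is Num.real by apply: ger0_real; apply: sumr_ge0.
rewrite CrealE -(inj_eq (mulIf q_neq0)) -pq -p_real pq rmorphM /=.
by rewrite (conj_Creal q_real).
Qed.

Lemma is_spectrum_exists : exists s, is_spectrum s.
Proof.
pose c := real_complex R.
have [r rE] := closed_field_poly_normal (map_poly c (char_poly laplacian_mx)).
rewrite lead_coef_map (monicP (char_poly_monic _)) rmorph1 scale1r in rE.
exists (sort <=%R (map (@complex.Re R) r)).
split; first exact: sort_sorted le_total _.
apply: (map_inj_poly (@complexI R) (rmorph0 _)); rewrite rE.
rewrite rmorph_prod /= (perm_big (map (@complex.Re R) r)) /= ?perm_sort //.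
rewrite big_map big_seq [RHS]big_seq; apply: eq_bigr => z zr.
rewrite map_polyXsubC /=; congr (_ - _%:P).
have : root (map_poly c (char_poly laplacian_mx)) z.
  by rewrite rE root_prod_XsubC.
rewrite map_char_poly -eigenvalue_root_char => /laplacian_eigenvalue_real.
by move=> /RRe_real.
Qed.

Definition spectrum : seq R := xget [::] [set s | is_spectrum s].

Lemma spectrumP : is_spectrum spectrum.
Proof. by have [s sP] := is_spectrum_exists; exact: xgetI sP. Qed.

Lemma size_spectrum : size spectrum = #|G|.
Proof.
apply: succn_inj; rewrite -(size_char_poly laplacian_mx) (spectrumP).2.
by rewrite size_prod_XsubC.
Qed.

Lemma spectrum_bounds a : a \in spectrum -> 0 <= a <= 2.
Proof.
move=> as_.
have : eigenvalue laplacian_mx^T a.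
  rewrite eigenvalue_root_char /char_poly -det_tr /char_poly_mx linearB /=.
  rewrite tr_scalar_mx map_trmx trmxK -/(char_poly_mx _) -/(char_poly _).
  by rewrite spectrumP.2 root_prod_XsubC.
move=> /eigenvalueP[v vE v0].
have [i0 vi0] : exists i, v 0 i != 0.
  apply: contrapT => h; case/eqP: v0; apply/rowP => i; rewrite mxE.
  by apply: contrapT => vi; apply: h; exists i; apply/eqP.
case: (arg_maxP (P := xpredT) (fun i => `|v 0 i|) (i0 := i0) isT) => i _ vi_max.
have vi_gt0 : 0 < `|v 0 i|.
  by rewrite (lt_le_trans _ (vi_max i0 isT)) // normr_gt0.
pose d : R := (degree (enum_val i))%:R.
have avi : (1 - a) * v 0 i =
    d^-1 * \sum_j v 0 j * (adj (enum_val i) (enum_val j))%:R.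
  have := congr1 (fun M : 'rV_ _ => M 0 i) vE; rewrite !mxE mulrBl mul1r => <-.
  under eq_bigr do rewrite mxE laplacian_mxE mulrBr.
  rewrite sumrB mulr_sumr (bigD1 i) //= eqxx mulr1.
  rewrite big1 => [|j ji]; last by rewrite eq_sym (negbTE ji) mulr0.
  by rewrite addr0 opprB addrC subrK; apply: eq_bigr => j _; rewrite mulrCA.
have : `|1 - a| <= 1.
  rewrite -(ler_pM2r vi_gt0) mul1r -normrM avi normrM normfV.
  have [d0|d_neq0] := eqVneq d 0; first by rewrite d0 normr0 invr0 mul0r.
  have d_gt0 : 0 < d by rewrite lt_def d_neq0 ler0n.
  rewrite (gtr0_norm d_gt0) mulrC ler_pdivrMr //.
  apply: (le_trans (ler_norm_sum _ _ _)).
  have -> : `|v 0 i| * d =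
      \sum_(j < #|G|) `|v 0 i| * (adj (enum_val i) (enum_val j))%:R.
    rewrite -mulr_sumr -natr_sum /d; congr (_ * _%:R).
    rewrite /degree -sum1dep_card big_mkcond /=.
    rewrite (reindex (@enum_val G predT)) /=; last first.
      by apply: onW_bij; exact: enum_val_bij.
    by apply: eq_bigr => j _; case: adj.
  apply: ler_sum => j _; rewrite normrM normr_nat ler_wpM2r ?ler0n //.
  exact: vi_max.
by rewrite ler_norml => /andP[h1 h2]; apply/andP; split; lra.
Qed.

(* For the empty graph this is the zero measure. *)
Definition spectral_measure : {measure set R -> \bar R} :=
  mscale ((#|G|%:R : R)^-1)%:nng (msum (fun i => \d_(spectrum`_i)) #|G|).

End Spectrum.

Arguments laplacian {R} G f.
Arguments laplacian_mx R G : clear implicits.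
Arguments is_spectrum {R} G s.
Arguments spectrum R G : clear implicits.
Arguments spectral_measure R G : clear implicits.

(* A measure on [0, 2] is encoded as a measure on the line that vanishes off
   [0, 2]; by [spectrum_bounds], [spectral_measure R G] is one.  The finite
   Borel measures on [0, 2] are exactly its Radon measures. *)
Definition in_spectral_class (R : realType) (G : nat -> sgraph)
    (rho : {finite_measure set R -> \bar R}) : Prop :=
  rho (~` `[0, 2]) = 0%E /\
  forall f : R -> R, {within `[0, 2], continuous f} ->
    (\int[spectral_measure R (G n)]_(x in `[0%R, 2%R]) (f x)%:E)%E
      @[n --> \oo] --> (\int[rho]_(x in `[0%R, 2%R]) (f x)%:E)%E.

(* Main.v *)
Require Import Defs.
From mathcomp Require Import all_boot all_order all_algebra.
From mathcomp Require Import all_classical all_reals all_analysis.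
From mathcomp Require Import measurable_realfun ring lra.

(** The mean over the spectrum of [(a - 1) ^+ 2] tends to [0] for both families,
    and by Chebyshev's argument this forces the spectral measures to
    concentrate at [1].

    With [L] the Laplacian matrix, the sum of [(a - 1) ^+ 2] over the eigenvalues
    [a] is [tr ((L - 1)^2)].  As [1 - L] has entry [1 / d_x] at adjacent [x],
    [y] and [0] elsewhere, this is the sum of [1 / (d_x d_y)] over the ordered
    pairs of adjacent vertices ([sum_spectrum_sub1_sqr]).  That the eigenvalues
    of [L^2] are the squares of those of [L], with multiplicity, is read off
    [det (X^2 - L^2) = det (X - L) det (X + L)] ([char_poly_mulmx_self]), so
    no eigenvector has to be exhibited.

    The sum is [n / (n - 1)] for the complete graph on [n >= 2] vertices, and [2] for
    every complete bipartite graph with two nonempty sides, so in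
    both cases it is at most [2] while the number of vertices grows
    ([in_spectral_class_dirac1_bounded]).  A continuous [f] on [[0, 2]] satisfies
    [`|f x - f 1| <= e + C * (x - 1) ^+ 2] ([continuous_le_sqr_dist]); averaging
    over the spectrum bounds the distance from the integral of [f] to [f 1]
    ([in_spectral_class_dirac1]). *)

Set Implicit Arguments.
Unset Strict Implicit.
Unset Printing Implicit Defensive.

Import Order.TTheory GRing.Theory Num.Theory.
Import numFieldNormedType.Exports.

Local Open Scope classical_set_scope.
Local Open Scope ring_scope.

(** * Eigenvalues of the square of a matrix *)

Lemma size_char_poly_roots (R : comNzRingType) n (A : 'M[R]_n) (s : seq R) :
  char_poly A = \prod_(a <- s) ('X - a%:P) -> size s = n.
Proof.
move=> As; apply: succn_inj.
by rewrite -(size_char_poly A) As size_prod_XsubC.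
Qed.

Lemma mxtrace_char_poly_roots (R : comNzRingType) n (A : 'M[R]_n) (s : seq R) :
  char_poly A = \prod_(a <- s) ('X - a%:P) -> \tr A = \sum_(a <- s) a.
Proof.
move=> As; have sn := size_char_poly_roots As.
case: n => [|n] in A As sn *.
  by rewrite (size0nil sn) big_nil /mxtrace big_ord0.
by apply: oppr_inj; rewrite -char_poly_trace // As -coefPn_prod_XsubC sn.
Qed.

(** Substituting ['X^2] for ['X] turns the claim into
    [det (X^2 - A^2) = det (X - A) det (X + A)], where the last factor is, up to
    the sign [(-1) ^+ n], the characteristic polynomial of [A] at [- 'X]; the
    substitution is injective. *)
Lemma char_poly_mulmx_self (R : idomainType) n (A : 'M[R]_n) (s : seq R) :
  char_poly A = \prod_(a <- s) ('X - a%:P) ->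
  char_poly (A *m A) = \prod_(a <- s) ('X - (a ^+ 2)%:P).
Proof.
move=> As; have sn := size_char_poly_roots As.
apply/eqP; rewrite -subr_eq0 -(@comp_poly_eq0 _ _ ('X^2)) ?size_polyXn //.
rewrite comp_polyB subr_eq0; apply/eqP.
have detD : \det ('X%:M + map_mx polyC A) = \prod_(a <- s) ('X + a%:P).
  have -> : 'X%:M + map_mx polyC A =
      (-1) *: map_mx (comp_poly (- 'X)) (char_poly_mx A).
    rewrite /char_poly_mx map_mxB /= map_scalar_mx /= comp_polyX scaleN1r.
    rewrite -map_mx_comp opprB addrC; congr (_ + _).
      by apply/matrixP => i j; rewrite !mxE /= comp_polyC.
    by rewrite raddfN opprK.
  rewrite detZ det_map_mx -/(char_poly A) As rmorph_prod /= -sn.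
  elim: s {As sn} => [|a s IHs]; first by rewrite !big_nil mulr1.
  rewrite /= !big_cons -IHs exprS comp_polyB comp_polyX comp_polyC; ring.
have -> : char_poly (A *m A) \Po 'X^2 =
    \det (char_poly_mx A *m ('X%:M + map_mx polyC A)).
  rewrite /char_poly -det_map_mx; congr (\det _).
  rewrite /char_poly_mx mulmxDr !mulmxBl -scalar_mxM scalar_mxC -expr2.
  rewrite addrA subrK map_mxB /= map_scalar_mx /= comp_polyX -map_mxM.
  rewrite -map_mx_comp; congr (_ - _).
  by apply/matrixP => i j; rewrite !mxE /= comp_polyC.
rewrite det_mulmx detD -/(char_poly A) As -big_split /= rmorph_prod /=.
apply: eq_bigr => a _; rewrite comp_polyB comp_polyX comp_polyC polyC_exp.
ring.
Qed.

Section RandicSum.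

(** * The second moment of the spectrum about one *)

Variable R : realType.
Implicit Types G : sgraph.

(** Each edge is counted in both directions: this is twice the general Randic
    index of exponent [-1]. *)
Definition randic_sum G : R :=
  \sum_(x : G) \sum_(y : G | adj x y) ((degree x)%:R * (degree y)%:R)^-1.

Lemma randic_sum_ge0 G : 0 <= randic_sum G.
Proof.
by apply: sumr_ge0 => x _; apply: sumr_ge0 => y _; rewrite invr_ge0 mulr_ge0.
Qed.

(** Both sides are [\tr ((L - 1) *m (L - 1))] for the Laplacian matrix [L]: the
    left one by expanding the square and using the eigenvalues of [L] and
    [L *m L], the right one by the entries of [L - 1]. *)
Lemma sum_spectrum_sub1_sqr G :
  \sum_(a <- spectrum R G) (a - 1) ^+ 2 = randic_sum G.
Proof.
have [_ Ls] := spectrumP R G; set L := laplacian_mx R G in Ls.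
have trL := mxtrace_char_poly_roots Ls.
have trL2 : \tr (L *m L) = \sum_(a <- spectrum R G) a ^+ 2.
  rewrite -(big_map (fun a => a ^+ 2) xpredT id) /=.
  by apply: mxtrace_char_poly_roots; rewrite big_map (char_poly_mulmx_self Ls).
have -> : \sum_(a <- spectrum R G) (a - 1) ^+ 2 =
    \tr ((L - 1%:M) *m (L - 1%:M)).
  have one : #|G|%:R = \sum_(a <- spectrum R G) 1 :> R.
    by rewrite big_const_seq count_predT iter_addr addr0 size_spectrum.
  rewrite mulmxBl mulmxBr mul1mx mulmx1 !raddfB /= trL trL2 mxtrace1 one.
  rewrite -opprD opprB -!sumrB -big_split; apply: eq_bigr => a _ /=; ring.
rewrite /randic_sum [RHS](reindex (@enum_val G predT)) /=; last first.
  by apply: onW_bij; exact: enum_val_bij.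
rewrite /mxtrace; apply: eq_bigr => i _; rewrite mxE.
rewrite [RHS]big_mkcond (reindex (@enum_val G predT)) /=; last first.
  by apply: onW_bij; exact: enum_val_bij.
have E k l : (L - 1%:M) k l = - ((degree (enum_val k))%:R^-1 *
                (adj (enum_val k) (enum_val l))%:R).
  by rewrite mxE laplacian_mxE !mxE addrAC subrr add0r.
apply: eq_bigr => j _; rewrite !E mulrNN (adj_sym (enum_val j)).
by case: adj; rewrite ?mulr1 ?invfM ?mulr0.
Qed.

(** * Weak convergence to the Dirac measure at one *)

Lemma integral_spectral_measure G (f : R -> R) :
  measurable_fun (`[0, 2] : set R) f ->
  (\int[spectral_measure R G]_(x in `[0%R, 2%R]) (f x)%:E =
   (#|G|%:R^-1 * \sum_(a <- spectrum R G) f a)%:E)%E.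
Proof.
have itv02 : measurable (`[0, 2] : set R) by [].
(* The integral is linear in the measure for nonnegative functions; signed ones
   are split into positive and negative parts. *)
have ge0 (g : R -> R) :
    measurable_fun (`[0, 2] : set R) g -> (forall x, 0 <= g x) ->
    (\int[spectral_measure R G]_(x in `[0%R, 2%R]) (g x)%:E =
     (#|G|%:R^-1 * \sum_(a <- spectrum R G) g a)%:E)%E.
  move=> mg g0; have /measurable_EFinP mEg := mg.
  rewrite /spectral_measure ge0_integral_mscale //=; last first.
    by move=> x _; rewrite lee_fin.
  rewrite ge0_integral_measure_sum //=; last by move=> x _; rewrite lee_fin.
  rewrite EFinM -sumEFin; congr (_ * _)%E.
  rewrite (big_nth 0) size_spectrum big_mkord; apply: eq_bigr => i _.
  rewrite integral_dirac //= diracE mem_set ?mul1e //=.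
  rewrite in_itv /=; apply: (@spectrum_bounds _ G).
  by rewrite mem_nth // size_spectrum.
move=> mf; have /measurable_EFinP mEf := mf.
rewrite integralE funerpos funerneg /=.
have mP : measurable_fun (`[0, 2] : set R) (f^\+)%R by exact: measurable_funrpos.
have mN : measurable_fun (`[0, 2] : set R) (f^\-)%R by exact: measurable_funrneg.
rewrite (ge0 _ mP (funrpos_ge0 f)) (ge0 _ mN (funrneg_ge0 f)).
rewrite -EFinB -mulrBr -sumrB; congr (_ * _)%:E.
by apply: eq_bigr => a _; rewrite -[in RHS](funrposBneg f).
Qed.

(** Within some distance [d] of [1] continuity gives the bound [e]; farther away
    [(x - 1) ^+ 2 >= d ^+ 2], so it is enough that [C * d ^+ 2] be the oscillation
    of [f] on the whole interval. *)
Lemma continuous_le_sqr_dist (f : R -> R) (e : R) : 0 < e ->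
  {within `[0, 2], continuous f} ->
  exists2 C : R, 0 <= C &
    forall x, x \in `[0, 2] -> `|f x - f 1| <= e + C * (x - 1) ^+ 2.
Proof.
move=> e0 cf.
have [b _ fb] := EVT_max (ler0n R 2) cf.
have [c _ fc] := EVT_min (ler0n R 2) cf.
have in1 : (1 : R) \in `[0, 2] by rewrite in_itv /=; apply/andP; split; lra.
have /subspace_continuousP /(_ 1 in1) /cvgrPdist_le /(_ e e0) := cf.
rewrite /within /prop_near1 /= => /nbhs_ballP[d /= d0 fd].
have fcb : 0 <= f b - f c.
  by rewrite subr_ge0 (le_trans (fc _ in1)) // fb.
exists ((f b - f c) / d ^+ 2); first by rewrite divr_ge0 // sqr_ge0.
move=> x x02; have [xd|dx] := ltP `|1 - x| d.
  rewrite distrC (le_trans (fd x xd x02)) // lerDl mulr_ge0 ?sqr_ge0 //.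
  by rewrite divr_ge0 // sqr_ge0.
have fx : `|f x - f 1| <= f b - f c.
  have := fb _ x02; have := fc _ x02; have := fb _ in1; have := fc _ in1.
  by move=> ? ? ? ?; rewrite ler_norml; apply/andP; split; lra.
rewrite (le_trans fx) // -[leLHS]add0r lerD ?(ltW e0) //.
rewrite -mulrA ler_peMr // mulrC ler_pdivlMr ?exprn_gt0 // mul1r.
by rewrite -(real_normK (num_real (x - 1))) distrC lerXn2r // nnegrE ltW.
Qed.

(** Chebyshev's argument: by [sum_spectrum_sub1_sqr] the quotient is the mean of
    [(a - 1) ^+ 2] over the spectrum, and [continuous_le_sqr_dist] controls the
    mean of [`|f a - f 1|] by it. *)
Lemma in_spectral_class_dirac1 (G : nat -> sgraph) :
  (\forall n \near \oo, (0 < #|G n|)%N) ->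
  randic_sum (G n) / #|G n|%:R @[n --> \oo] --> 0 ->
  in_spectral_class G (\d_(1 : R)).
Proof.
move=> G_gt0 rG; have in1 : (`[0, 2]%classic : set R) 1.
  by rewrite /= in_itv /=; apply/andP; split; lra.
split; first by rewrite /= diracE memNset //; apply.
move=> f cf.
have mf : measurable_fun (`[0, 2] : set R) f.
  exact: subspace_continuous_measurable_fun.
rewrite integral_dirac //=; last exact/measurable_EFinP.
rewrite diracE mem_set // mul1e.
under eq_cvg do rewrite integral_spectral_measure //.
apply: cvg_EFin; first by near=> n.
apply/cvgrPdist_le => e e0; rewrite /comp /=.
have e20 : 0 < e / 2 by rewrite divr_gt0.
have [C C0 fC] := continuous_le_sqr_dist e20 cf.
(* [C] may vanish, so divide by [C + 1] instead. *)
have C1 : 0 < C + 1 by rewrite ltr_wpDl.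
have eC0 : 0 < e / 2 / (C + 1) by rewrite divr_gt0.
move/cvgrPdist_le : rG => /(_ _ eC0) rG.
near=> n.
have N0 : 0 < (#|G n|%:R : R) by rewrite ltr0n; near: n.
have rn : `|0 - randic_sum (G n) / #|G n|%:R| <= e / 2 / (C + 1) by near: n.
have r0 : 0 <= randic_sum (G n) / #|G n|%:R.
  by rewrite divr_ge0 // randic_sum_ge0.
rewrite sub0r normrN ger0_norm // in rn.
have -> : f 1 - #|G n|%:R^-1 * \sum_(a <- spectrum R (G n)) f a =
    - (#|G n|%:R^-1 * \sum_(a <- spectrum R (G n)) (f a - f 1)).
  rewrite sumrB mulrBr opprB; congr (_ - _).
  rewrite big_const_seq count_predT iter_addr addr0 size_spectrum.
  by rewrite -[f 1 *+ _]mulr_natl mulKf // gt_eqF.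
rewrite normrN normrM ger0_norm ?invr_ge0 ?(ltW N0) //.
rewrite mulrC ler_pdivrMr //.
apply: (le_trans (ler_norm_sum _ _ _)).
apply: (@le_trans _ _
    (\sum_(a <- spectrum R (G n)) (e / 2 + C * (a - 1) ^+ 2))).
  rewrite big_seq [leRHS]big_seq; apply: ler_sum => a aG.
  by apply: fC; rewrite in_itv /=; exact: (@spectrum_bounds _ (G n)).
rewrite big_split /= -[X in _ + X]mulr_sumr sum_spectrum_sub1_sqr.
rewrite big_const_seq count_predT iter_addr addr0 size_spectrum.
rewrite -[e / 2 *+ _]mulr_natr -ler_pdivrMr // mulrDl mulfK ?gt_eqF //.
rewrite [leRHS](splitr e) lerD2l -mulrA.
apply: (@le_trans _ _ ((C + 1) * (e / 2 / (C + 1)))).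
  by rewrite ler_pM // lerDl.
by rewrite mulrC divfK // gt_eqF.
Unshelve. all: by end_near. Qed.

Lemma in_spectral_class_dirac1_bounded (G : nat -> sgraph) (C : R) :
  (\forall n \near \oo, #|G n| = n /\ randic_sum (G n) <= C) ->
  in_spectral_class G (\d_(1 : R)).
Proof.
move=> GC; apply: in_spectral_class_dirac1.
  near=> n; have [-> _] : #|G n| = n /\ randic_sum (G n) <= C by near: n.
  by near: n; exact: nbhs_infty_gt.
apply/cvgrPdist_le => e e0; near=> n.
have [-> rC] : #|G n| = n /\ randic_sum (G n) <= C by near: n.
have n0 : 0 < (n%:R : R) by rewrite ltr0n; near: n; exact: nbhs_infty_gt.
rewrite sub0r normrN ger0_norm; last first.
  by rewrite divr_ge0 // randic_sum_ge0.
rewrite ler_pdivrMr // (le_trans rC) // mulrC -ler_pdivrMr //.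
by near: n; exact: nbhs_infty_ger.
Unshelve. all: by end_near. Qed.

(** * Complete and complete bipartite graphs *)

Lemma degree_complete_graph n (x : complete_graph n) : degree x = n.-1.
Proof.
rewrite /degree -[in RHS](card_ord n) -(cardsC1 x); apply: eq_card => y.
by rewrite !inE /= eq_sym.
Qed.

Lemma randic_sum_complete_graph n :
  randic_sum (complete_graph n.+2) = n.+2%:R / n.+1%:R.
Proof.
have inner (x : complete_graph n.+2) :
    \sum_(y : complete_graph n.+2 | adj x y)
      ((degree x)%:R * (degree y)%:R)^-1 = n.+1%:R^-1 :> R.
  under eq_bigr do rewrite !degree_complete_graph /=.
  rewrite sumr_const -cardsE -/(degree x) degree_complete_graph /=.
  by rewrite -[_ *+ n.+1]mulr_natr invfM -mulrA mulVf ?pnatr_eq0 // mulr1.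
rewrite /randic_sum (eq_bigr _ (fun x _ => inner x)).
by rewrite sumr_const card_ord mulr_natl.
Qed.

Section Bipartite.
Variables n1 n2 : nat.
Let K := complete_bipartite_graph n1 n2.

Lemma degree_complete_bipartite_inl (i : 'I_n1) : degree (inl i : K) = n2.
Proof.
rewrite /degree cardsE -sum1_card big_sumType /= big_pred0 // add0n.
by rewrite sum1_card card_ord.
Qed.

Lemma degree_complete_bipartite_inr (j : 'I_n2) : degree (inr j : K) = n1.
Proof.
rewrite /degree cardsE -sum1_card big_sumType /= addnC big_pred0 // add0n.
by rewrite sum1_card card_ord.
Qed.

(** In each of the two directions there are [n1 * n2] edges, all of weight
    [1 / (n1 * n2)]. *)
Lemma randic_sum_complete_bipartite_graph : (0 < n1)%N -> (0 < n2)%N ->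
  randic_sum K = 2.
Proof.
move=> n1_gt0 n2_gt0; rewrite /randic_sum big_sumType /=.
have E (m1 m2 : nat) : (0 < m1)%N -> (0 < m2)%N ->
    (m1%:R * m2%:R)^-1 *+ m2 *+ m1 = 1 :> R.
  move=> m1_gt0 m2_gt0.
  rewrite -mulrnA -[_ *+ (m2 * m1)]mulr_natr mulnC natrM mulVf //.
  by rewrite mulf_neq0 ?pnatr_eq0 -?lt0n.
congr (_ + _).
  under eq_bigr => i _.
    rewrite big_sumType /= big_pred0 // add0r.
    under eq_bigr do
      rewrite degree_complete_bipartite_inl degree_complete_bipartite_inr mulrC.
    rewrite sumr_const card_ord.
    over.
  by rewrite sumr_const card_ord E.
under eq_bigr => j _.
  rewrite big_sumType /= [X in _ + X]big_pred0 // addr0.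
  under eq_bigr do
      rewrite degree_complete_bipartite_inl degree_complete_bipartite_inr mulrC.
  rewrite sumr_const card_ord.
  over.
by rewrite sumr_const card_ord E.
Qed.

End Bipartite.

End RandicSum.

Theorem proposition2p2 (R : realType) :
  in_spectral_class (fun n : nat => complete_graph n) (\d_(1 : R)) /\
  (forall n1 n2 : nat -> nat,
    (forall n : nat, (2 <= n)%N ->
      [/\ (n1 n + n2 n)%N = n, (1 <= n1 n)%N & (1 <= n2 n)%N]) ->
    in_spectral_class (fun n : nat => complete_bipartite_graph (n1 n) (n2 n))
      (\d_(1 : R))).
Proof.
split=> [|n1 n2 n12].
  have rK n : (2 <= n)%N -> randic_sum R (complete_graph n) <= 2.
    case: n => [//|[//|n]] _; rewrite randic_sum_complete_graph.
    rewrite ler_pdivrMr // -natrM ler_nat mul2n -addnn addSn addnS !ltnS.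
    exact: leq_addr.
  apply: (@in_spectral_class_dirac1_bounded _ _ 2).
  near=> n; rewrite card_ord; split=> //.
  by apply: rK; near: n; exact: nbhs_infty_ge.
apply: (@in_spectral_class_dirac1_bounded _ _ 2); near=> n.
have [//|n12E n1_gt0 n2_gt0] := n12 n.
  by near: n; exact: nbhs_infty_gt.
by rewrite card_sum !card_ord randic_sum_complete_bipartite_graph.
Unshelve. all: by end_near. Qed.
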